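(* Let $n\ge 2$ and $k\ge 1$ be integers and let $$A_{n,k}:=\{a\in(\mathbb{Z}/n\mathbb{Z})^\times : a^k\in\{\pm1\}\}.$$ For all $a,b\in A_{n,k}$, $$\left(\frac{ab}{n}\right)_k=\left(\frac{a}{n}\right)_k\left(\frac{b}{n}\right)_k.$$
   Context: For integers $n\ge 2$, $k\ge 1$ and $a\in\mathbb{Z}$, the exponential congruence symbol $\left(\frac{a}{n}\right)_k\in\{-1,0,1\}$ is defined to be $1$ if $a^k\equiv 1\pmod n$, $-1$ if $a^k\equiv -1\pmod n$, and $0$ otherwise. The cases are read in order, the first applicable one being used; this matters only for $n=2$. The symbol depends only on the residue class of $a$ modulo $n$, so it is also regarded as a function on $\mathbb{Z}/n\mathbb{Z}$. In the definition of $A_{n,k}$, $\{\pm1\}$ denotes the residue classes of $1$ and $-1$ modulo $n$. *)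

(* Defs.v *)
From mathcomp Require Import all_boot all_order all_algebra.

Set Implicit Arguments.
Unset Strict Implicit.
Unset Printing Implicit Defensive.

Import GRing.Theory.
Local Open Scope ring_scope.

Definition expsymb (n k : nat) (a : int) : int :=
  if (a ^+ k == 1 %[mod n])%Z then 1
  else if (a ^+ k == -1 %[mod n])%Z then -1
  else 0.

(* Only meaningful for 1 < n, where 'Z_n is Z/nZ; the value is computed on the
   representative of a in {0, ..., n-1}, and expsymb_ZpE below shows that any
   other representative gives the same value. *)
Definition expsymb_Zp (n k : nat) (a : 'Z_n) : int :=
  expsymb n k (Posz (a : nat)).

Definition expA (n k : nat) : {set 'Z_n} :=
  [set a : 'Z_n | (a \is a GRing.unit) && (a ^+ k \in [set 1; -1])].

Lemma expsymb_mod (n k : nat) (a b : int) :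
  (a = b %[mod n])%Z -> expsymb n k a = expsymb n k b.
Proof.
move=> eq_ab; have eq_abk : (a ^+ k = b ^+ k %[mod n])%Z.
  by rewrite -modzXm eq_ab modzXm.
by rewrite /expsymb eq_abk.
Qed.

Lemma expsymb_ZpE (n k : nat) (a : int) :
  (1 < n)%N -> expsymb_Zp k (a%:~R : 'Z_n) = expsymb n k a.
Proof.
move=> n_gt1; apply: expsymb_mod.
have valZ (m : nat) : Posz (m%:R : 'Z_n) = (m %% n)%Z.
  by rewrite val_Zp_nat // modz_nat.
have n_neq0 : n%:Z != 0 by case: n n_gt1 {valZ}.
have [m Em] : exists m : nat, (a %% n)%Z = m.
  by exists `|(a %% n)%Z|%N; rewrite gez0_abs // modz_ge0.
have -> : a%:~R = m%:R :> 'Z_n.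
  rewrite (divz_eq a n) Em rmorphD rmorphM /= -!pmulrn.
  by rewrite (pchar_Zp n_gt1) mulr0 add0r.
by rewrite valZ -Em !modz_mod.
Qed.

(* Main.v *)
Require Import Defs.
From mathcomp Require Import all_boot all_order all_algebra.

Import GRing.Theory.
Local Open Scope ring_scope.

(** As ['Z_n] is commutative, $(ab)^k=a^kb^k$. On $A_{n,k}$ the symbol is $a^k=\pm1$ read as an
    integer sign, and this reading is multiplicative: if $n>2$ it is an isomorphism of $\{\pm1\}$
    onto the integer signs, and if $n=2$ it is constantly $1$. *)

Lemma intr_Zp_eq0 (n : nat) (x : int) :
  (1 < n)%N -> (x%:~R == 0 :> 'Z_n) = (n %| x)%Z.
Proof.
move=> n_gt1.
have natE (m : nat) : (m%:R == 0 :> 'Z_n) = (n %| m)%N.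
  by rewrite -val_eqE /= val_Zp_nat.
by case: x => m; rewrite dvdzE ?NegzE ?mulrNz ?oppr_eq0 -pmulrn natE.
Qed.

Lemma eqz_mod_Zp (n : nat) (x y : int) :
  (1 < n)%N -> (x == y %[mod n])%Z = (x%:~R == y%:~R :> 'Z_n).
Proof.
by move=> n_gt1; rewrite eqz_mod_dvd -intr_Zp_eq0 // rmorphB subr_eq0.
Qed.

(** Trades integer congruences on representatives for equations in ['Z_n], so that the
    representative of a product never has to be computed. *)
Lemma expsymb_Zp_expr (n k : nat) (a : 'Z_n) : (1 < n)%N ->
  expsymb_Zp k a = if a ^+ k == 1 then 1 else if a ^+ k == -1 then -1 else 0.
Proof.
move=> n_gt1; rewrite /expsymb_Zp /expsymb !eqz_mod_Zp //.
by rewrite rmorphXn rmorphN /= -pmulrn natr_Zp.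
Qed.

Theorem corollary2p2 (n k : nat) (hn : (2 <= n)%N) (hk : (1 <= k)%N)
    (a b : 'Z_n) (ha : a \in expA n k) (hb : b \in expA n k) :
  expsymb_Zp k (a * b) = expsymb_Zp k a * expsymb_Zp k b.
Proof.
move: ha hb; rewrite !inE => /andP[_ ha] /andP[_ hb].
rewrite !expsymb_Zp_expr // exprMn.
case/orP: ha => /eqP->; rewrite ?eqxx ?mul1r //.
(* Here $a^k=-1$. The final [ifP] asks whether $-1=1$ in ['Z_n], which happens exactly for $n=2$. *)
by case/orP: hb => /eqP->; rewrite ?mulrNN ?mulr1 !eqxx ?mulr1; case: ifP.
Qed.
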